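(* For every fixed integer $m\ge 2$, the optimization problem Maximizing Average Profit (MAP) with $m$ parts can be solved in pseudo-polynomial time.
   Context: Maximizing Average Profit (MAP) with $m$ parts. Instance: two finite lists of positive integers (repetitions allowed) $A=(a_1,\dots,a_n)$ and $B=(b_1,\dots,b_n)$ of the same length $n\ge 1$. Put $I=\{1,2,\dots,n\}$. For a partition of $I$ into $m$ pairwise disjoint subsets $I_1,\dots,I_m$ with union $I$, let $$r_j=\frac{\sum_{i\in I_j}a_i}{\sum_{i\in I_j}b_i},\qquad j=1,\dots,m,$$ where by convention a fraction with denominator $0$ has value $0$ (so $r_j=0$ if $I_j=\emptyset$), and let $$f(I_1,\dots,I_m)=\min_{1\le j\le m} r_j.$$ Task: determine the maximum value of $f$ over all partitions of $I$ into $m$ disjoint subsets. Here $m$ is fixed and is not part of the input. A problem is solvable in pseudo-polynomial time if there is an algorithm that correctly solves every instance in time bounded by a polynomial in the length of the instance and the largest integer occurring in it. *)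

(* Defs.v *)
(* MathComp *)
From HB Require Import structures.
From mathcomp Require Import all_boot all_order all_algebra.
Set Implicit Arguments. Unset Strict Implicit. Unset Printing Implicit Defensive.
Import Order.TTheory GRing.Theory Num.Theory.
Local Open Scope nat_scope.

(* Algorithms are structured programs for a random access machine with
   registers indexed by nat, and time is measured by the logarithmic cost
   criterion: every operation is charged the bit lengths of the addresses and
   numbers it handles. This model and Turing machines simulate each other with
   polynomial overhead. *)

Definition bitlen (x : nat) : nat := (trunc_log 2 x).+1.

Inductive arith_op : Type := Add | Sub | Mul | Div.

(* Sub is truncated, and Div is the Euclidean quotient with x / 0 = 0. *)
Definition eval_op (o : arith_op) : nat -> nat -> nat :=
  match o with Add => addn | Sub => subn | Mul => muln | Div => divn end.

Inductive expr : Type :=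
| Lit of nat
| Fetch of expr
| Op of arith_op & expr & expr.

Inductive program : Type :=
| Skip
| Store of expr & expr
| Seq of program & program
| If of expr & program & program
| While of expr & program.

Definition memory : Type := nat -> nat.

Fixpoint eval (s : memory) (e : expr) : nat :=
  match e with
  | Lit k => k
  | Fetch e => s (eval s e)
  | Op o e1 e2 => eval_op o (eval s e1) (eval s e2)
  end.

Fixpoint eval_cost (s : memory) (e : expr) : nat :=
  match e with
  | Lit k => bitlen k
  | Fetch e => eval_cost s e + bitlen (eval s e) + bitlen (s (eval s e))
  | Op _ e1 e2 =>
      eval_cost s e1 + eval_cost s e2 + bitlen (eval s e1) + bitlen (eval s e2)
  end.

Definition store (s : memory) (i v : nat) : memory :=
  fun k => if k == i then v else s k.

Definition test_cost (s : memory) (e : expr) : nat :=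
  eval_cost s e + bitlen (eval s e).

(* [exec c s t s']: started in memory s, the program c halts after time t in
   memory s'. A test succeeds when its value is nonzero. *)
Inductive exec : program -> memory -> nat -> memory -> Prop :=
| exec_skip s : exec Skip s 1 s
| exec_store s e1 e2 :
    exec (Store e1 e2) s (test_cost s e1 + test_cost s e2)
         (store s (eval s e1) (eval s e2))
| exec_seq c1 c2 s t1 s1 t2 s2 :
    exec c1 s t1 s1 -> exec c2 s1 t2 s2 -> exec (Seq c1 c2) s (t1 + t2) s2
| exec_if_true e c1 c2 s t s' :
    eval s e != 0 -> exec c1 s t s' -> exec (If e c1 c2) s (test_cost s e + t) s'
| exec_if_false e c1 c2 s t s' :
    eval s e = 0 -> exec c2 s t s' -> exec (If e c1 c2) s (test_cost s e + t) s'
| exec_while_true e c s t1 s1 t2 s2 :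
    eval s e != 0 -> exec c s t1 s1 -> exec (While e c) s1 t2 s2 ->
    exec (While e c) s (test_cost s e + t1 + t2) s2
| exec_while_false e c s :
    eval s e = 0 -> exec (While e c) s (test_cost s e) s.

Lemma exec_det (c : program) (s : memory) (t1 t2 : nat) (s1 s2 : memory) :
  exec c s t1 s1 -> exec c s t2 s2 -> t1 = t2 /\ s1 = s2.
Proof.
move=> H; elim: H t2 s2 => {c s t1 s1}; intros;
  match goal with H : exec _ _ ?t ?s |- _ = ?t /\ _ = ?s => inversion H; subst end;
  repeat match goal with
  | E : eval ?s ?e = 0, N : is_true (eval ?s ?e != 0) |- _ => by rewrite E in N
  | IH : forall t s, exec ?c ?s0 t s -> _, H : exec ?c ?s0 _ _ |- _ =>
      case: (IH _ _ H) => ? ?; clear IH; subst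
  end; by [].
Qed.

(* A computational problem whose instances are presented as finite lists of
   natural numbers and whose answers are rational numbers. *)
Record problem : Type := Problem {
  instance : Type;
  data : instance -> seq nat;
  answer : instance -> rat -> Prop
}.

(* Numbers are written in binary. *)
Definition instance_length (P : problem) (x : instance P) : nat :=
  \sum_(k <- data x) bitlen k.

Definition largest_integer (P : problem) (x : instance P) : nat :=
  \max_(k <- data x) k.

(* Register 0 holds the number of input integers, the next registers hold the
   integers themselves, and all other registers are 0. *)
Definition init_memory (l : seq nat) : memory := nth 0 (size l :: l).

(* The answer is returned as a fraction: its numerator in register 0 and its
   nonzero denominator in register 1. *)
Definition output (s : memory) : rat := ((s 0)%:R / (s 1)%:R)%R.

(* p is a polynomial in two variables: the outer one is evaluated at the
   largest integer, the inner one at the length. *)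
Definition pseudo_polynomial_time (P : problem) : Prop :=
  exists (c : program) (p : {poly {poly nat}}),
  forall x : instance P, exists (t : nat) (s : memory),
  [/\ exec c (init_memory (data x)) t s,
      t <= (p.[(largest_integer x)%:P].[instance_length x])%R,
      s 1 != 0
    & answer x (output s)].

Record map_instance : Type := MAPInstance {
  items : nat;
  nums : items.-tuple nat;
  dens : items.-tuple nat;
  items_gt0 : 0 < items;
  nums_gt0 : forall i : 'I_items, 0 < tnth nums i;
  dens_gt0 : forall i : 'I_items, 0 < tnth dens i
}.

(* The parts are labelled, and may be empty. *)
Definition is_partition (n m : nat) (I : 'I_m -> {set 'I_n}) : Prop :=
  (forall j k : 'I_m, j != k -> [disjoint I j & I k]) /\
  \bigcup_(j < m) I j = [set: 'I_n].

(* Division by 0 in rat yields 0. *)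
Definition part_ratio (x : map_instance) (J : {set 'I_(items x)}) : rat :=
  ((\sum_(i in J) tnth (nums x) i)%:R / (\sum_(i in J) tnth (dens x) i)%:R)%R.

(* The minimum of a nonempty list. *)
Definition min_seq (r : seq rat) : rat := (\big[Num.min/head 0 r]_(v <- r) v)%R.

Definition min_ratio (x : map_instance) (m : nat)
    (I : 'I_m -> {set 'I_(items x)}) : rat :=
  min_seq [seq part_ratio (I j) | j <- enum 'I_m].

Definition is_map_optimum (m : nat) (x : map_instance) (v : rat) : Prop :=
  (exists I : 'I_m -> {set 'I_(items x)}, is_partition I /\ min_ratio I = v) /\
  (forall I : 'I_m -> {set 'I_(items x)}, is_partition I -> (min_ratio I <= v)%R).

Definition MAP (m : nat) : problem :=
  {| instance := map_instance;
     data := fun x => nums x ++ dens x;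
     answer := is_map_optimum m |}.

(* Main.v *)
Require Import Defs.
From mathcomp Require Import all_boot all_order all_algebra.
From mathcomp Require Import zify.
From Stdlib Require Import FunctionalExtensionality.

Set Implicit Arguments.
Unset Strict Implicit.
Unset Printing Implicit Defensive.

Import Order.TTheory GRing.Theory Num.Theory.

Local Open Scope nat_scope.

(** Dynamic programming over all vectors of part sums. With [n] items, put
    [W = 1 + \sum_i (a_i + b_i)], so that every part sum is a digit in base [W],
    and encode an assignment of the first [i] items to the [m] parts by the number
    whose [m] lowest digits are the sums of the [a]'s in each part, whose next [m]
    digits are the sums of the [b]'s, and whose remaining part is [i]. Putting
    item [i] in part [j] then adds to the code the number
    [W ^ (2 m) + W ^ j * (a_i + b_i * W ^ m)], which only depends on [i] and [j]:
    the reachable codes form a subset-sum problem. Since [m] is fixed, there are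
    at most [(n + 1) * W ^ (2 m)] codes, a polynomial number in [n] and the largest
    integer.

    The program computes [W] ([halts_compute_radix]), marks in a table all
    reachable codes in increasing order ([halts_fill_table]), then scans the
    marked codes of complete assignments and keeps the largest of their minimal
    ratios ([halts_scan_last_layer]). The fraction it returns is the optimum since
    the codes of complete assignments determine the part sums ([ratio_code]) and
    exactly those codes are marked ([closed_reachable], [reachable_last_layer]);
    this is [best_is_optimum].

    For the running time it is enough to be crude. All numbers handled by the
    program are polynomial in [(n + 1) * W ^ (2 m)], hence so is the cost of each
    operation, even when a number [x] is charged [x + 1] instead of its bit length.
    Thus the relation [halts], a total-correctness triple, only counts steps and
    asks that registers stay below a bound [V]; the cost of a step is bounded once
    and for all by a power of [V + 2] whose exponent depends on the text of the
    program alone ([test_cost_bounded]). *)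

(** * Running time from operation counts *)

Lemma bitlen_leS x : bitlen x <= x.+1.
Proof.
rewrite ltnS; case: x => [|x] //.
by rewrite (leq_trans (ltnW (ltn_expl _ (ltnSn 1)))) // trunc_logP.
Qed.

(** Exponents need not be sharp: [value_exp] is chosen so that one exponent serves
    both for the value of an expression and for the cost of computing it. *)
Fixpoint value_exp (e : expr) : nat :=
  match e with
  | Lit k => k
  | Fetch e => value_exp e + 3
  | Op _ e1 e2 => value_exp e1 + value_exp e2 + 3
  end.

Fixpoint cost_exp (c : program) : nat :=
  match c with
  | Skip => 0
  | Store e1 e2 => value_exp e1 + value_exp e2 + 2
  | Seq c1 c2 => cost_exp c1 + cost_exp c2
  | If e c1 c2 => value_exp e + 2 + (cost_exp c1 + cost_exp c2)
  | While e c => value_exp e + 2 + cost_exp c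
  end.

Definition bounded (V : nat) (s : memory) := forall i, s i <= V.

Lemma eval_bounded V s e : bounded V s ->
  eval s e <= (V + 2) ^ value_exp e /\ eval_cost s e <= (V + 2) ^ value_exp e.
Proof.
move=> bs; set B := V + 2; have B1 : 1 < B by rewrite /B; lia.
have B0 d : 0 < B ^ d by rewrite expn_gt0 ltnW.
elim: e => [k|e [IHv IHc]|o e1 [v1 c1] e2 [v2 c2]] /=.
- have ltk : k < B ^ k by exact: ltn_expl.
  by split; [exact: ltnW | exact: leq_trans (bitlen_leS k) _].
- have := bs (eval s e); rewrite expnD; set x := s _ => bx.
  have := bitlen_leS (eval s e); have := bitlen_leS x.
  move: (B0 (value_exp e)) IHv IHc; move: (B ^ _) (bitlen _) (bitlen x) => P y z.
  have -> : B ^ 3 = B * (B * B) by rewrite !expnS expn0 muln1.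
  move=> P0 IHv IHc hy hz.
  have hB : 4 * B <= B * (B * B) by nia.
  have hP : P * (4 * B) <= P * (B * (B * B)) by rewrite leq_mul2l hB orbT.
  have hVB : V + 2 = B by [].
  by split; nia.
have -> : B ^ (value_exp e1 + value_exp e2 + 3)
          = B ^ value_exp e1 * B ^ value_exp e2 * (B * (B * B)).
  by rewrite !expnD !expnS expn0 muln1.
move: (B0 (value_exp e1)) (B0 (value_exp e2)) v1 c1 v2 c2.
have := bitlen_leS (eval s e1); have := bitlen_leS (eval s e2).
move: (B ^ value_exp e1) (B ^ value_exp e2) (bitlen _) (bitlen _).
move=> P Q y z hy hz P0 Q0 v1 c1 v2 c2.
have h8 : P * Q * 8 <= P * Q * (B * (B * B)).
  by rewrite leq_mul2l; apply/orP; right; nia.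
have PQ1 : P <= P * Q by rewrite leq_pmulr.
have PQ2 : Q <= P * Q by rewrite leq_pmull.
split; last by nia.
have PQ : eval s e1 * eval s e2 <= P * Q by rewrite leq_mul.
have := leq_div (eval s e1) (eval s e2).
by case: o => /=; move: (_ * eval _ _) (_ %/ _) PQ => x q; nia.
Qed.

Lemma test_cost_bounded V s e :
  bounded V s -> test_cost s e <= (V + 2) ^ (value_exp e + 2).
Proof.
move=> /(@eval_bounded V s e)[hv hc].
have := bitlen_leS (eval s e); rewrite /test_cost expnD.
have : 0 < (V + 2) ^ value_exp e by rewrite expn_gt0 addn2.
have : 4 <= (V + 2) ^ 2 by rewrite (@leq_exp2r 2 _ 2) // addn2.
move: (_ ^ 2) (_ ^ _) hv hc => a b; nia.
Qed.

(** Total correctness with a time bound. The bound is not on the time itself but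
    on the number [n] of elementary steps: as long as no register exceeds [V], one
    step costs at most [(V + 2) ^ cost_exp c], so that the rules below only count
    steps and check that stored values stay below [V]. *)
Definition halts V c s n (Q : memory -> Prop) :=
  bounded V s -> exists t s',
  [/\ exec c s t s', t <= n * (V + 2) ^ cost_exp c, bounded V s' & Q s'].

Section Rules.
Variable V : nat.
Implicit Types (c : program) (s : memory) (e : expr) (Q : memory -> Prop).

Let pow_mono d d' : d <= d' -> (V + 2) ^ d <= (V + 2) ^ d'.
Proof. by move=> ?; rewrite leq_pexp2l // addn2. Qed.

Let pow_gt0 d : 0 < (V + 2) ^ d.
Proof. by rewrite expn_gt0 addn2. Qed.

Lemma halts_weaken c s n n' Q Q' : n <= n' -> (forall s', Q s' -> Q' s') ->
  halts V c s n Q -> halts V c s n' Q'.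
Proof.
move=> le_n QQ' h bs; have [t [s' [ex ht bs' /QQ' q]]] := h bs.
exists t, s'; split=> //; apply: leq_trans ht _.
by rewrite leq_mul2r le_n orbT.
Qed.

Lemma halts_skip s n Q : Q s -> halts V Skip s n.+1 Q.
Proof. by move=> q bs; exists 1, s; split; rewrite ?muln1 //; constructor. Qed.

Lemma halts_store e1 e2 s Q : eval s e2 <= V ->
  Q (store s (eval s e1) (eval s e2)) -> halts V (Store e1 e2) s 2 Q.
Proof.
move=> le_V q bs; exists (test_cost s e1 + test_cost s e2), (store s (eval s e1) (eval s e2)).
split=> //; first by constructor.
  rewrite mul2n -addnn /=; apply: leq_add; apply: leq_trans (test_cost_bounded _ bs) _;
  apply: pow_mono; lia.
by move=> i; rewrite /store; case: ifP.
Qed.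

Lemma halts_seq c1 c2 s n1 n2 Q :
  halts V c1 s n1 (fun s' => halts V c2 s' n2 Q) ->
  halts V (Seq c1 c2) s (n1 + n2) Q.
Proof.
move=> h bs; have [t1 [s1 [ex1 ht1 bs1 h2]]] := h bs.
have [t2 [s2 [ex2 ht2 bs2 q]]] := h2 bs1.
exists (t1 + t2), s2; split=> //; first exact: exec_seq ex1 ex2.
rewrite mulnDl leq_add //=.
  by apply: leq_trans ht1 _; rewrite leq_mul2l pow_mono ?orbT ?leq_addr.
by apply: leq_trans ht2 _; rewrite leq_mul2l pow_mono ?orbT ?leq_addl.
Qed.

Lemma halts_if e c1 c2 s n Q :
  (eval s e != 0 -> halts V c1 s n Q) -> (eval s e = 0 -> halts V c2 s n Q) ->
  halts V (If e c1 c2) s n.+1 Q.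
Proof.
move=> h1 h2 bs; have le_test := test_cost_bounded e bs.
have [e0|e_neq0] := eqVneq (eval s e) 0.
  have [t [s' [ex ht bs' q]]] := h2 e0 bs.
  exists (test_cost s e + t), s'; split=> //; first exact: exec_if_false.
  rewrite mulSn; apply: leq_add.
    by apply: leq_trans le_test (pow_mono _); rewrite /= leq_addr.
  apply: leq_trans ht _; rewrite leq_mul2l pow_mono ?orbT //=; lia.
have [t [s' [ex ht bs' q]]] := h1 e_neq0 bs.
exists (test_cost s e + t), s'; split=> //; first exact: exec_if_true.
rewrite mulSn; apply: leq_add.
  by apply: leq_trans le_test (pow_mono _); rewrite /= leq_addr.
apply: leq_trans ht _; rewrite leq_mul2l pow_mono ?orbT //=; lia.
Qed.

(** Termination comes from indexing the invariant by the number [k] of the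
    iteration: the test must succeed exactly as long as [k < hi]. *)
Lemma halts_while e c n (Inv : nat -> memory -> Prop) hi :
  (forall s, Inv hi s -> eval s e = 0) ->
  (forall k s, k < hi -> Inv k s -> eval s e != 0) ->
  (forall k s, k < hi -> Inv k s -> halts V c s n (Inv k.+1)) ->
  forall k s, k <= hi -> Inv k s ->
  halts V (While e c) s ((hi - k) * n.+1).+1 (Inv hi).
Proof.
move=> e_end e_run body k s le_k; move: {2}(hi - k) (erefl (hi - k)) => r.
elim: r k s le_k => [|r IH] k s le_k def_r inv bs.
  have def_k : k = hi by lia.
  rewrite {}def_k in le_k def_r inv *.
  exists (test_cost s e), s; split=> //; first by apply: exec_while_false; apply: e_end.
  rewrite subnn mul1n; apply: leq_trans (test_cost_bounded _ bs) _.
  by apply: pow_mono; rewrite /= leq_addr.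
have lt_k : k < hi by lia.
have [t1 [s1 [ex1 ht1 bs1 inv1]]] := body k s lt_k inv bs.
have [] := IH k.+1 s1 lt_k _ inv1 bs1; first by lia.
move=> t2 [s2 [ex2 ht2 bs2 inv2]].
exists (test_cost s e + t1 + t2), s2; split=> //.
  by apply: exec_while_true ex1 ex2; apply: e_run inv.
have -> : ((hi - k) * n.+1).+1 = 1 + n + ((hi - k.+1) * n.+1).+1 by nia.
rewrite mulnDl leq_add // mulnDl leq_add ?mul1n //.
  apply: leq_trans (test_cost_bounded _ bs) _.
  by apply: pow_mono; rewrite /= leq_addr.
by apply: leq_trans ht1 _; rewrite leq_mul2l pow_mono ?orbT //= leq_addl.
Qed.

Fixpoint seqs (f : nat -> program) (m : nat) : program :=
  if m is m'.+1 then Seq (seqs f m') (f m') else Skip.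

Lemma halts_seqs f n (Inv : nat -> memory -> Prop) m s :
  (forall j s, j < m -> Inv j s -> halts V (f j) s n (Inv j.+1)) ->
  Inv 0 s -> halts V (seqs f m) s (m * n).+1 (Inv m).
Proof.
elim: m => [|m IH] step inv0 /=; first exact: halts_skip.
have -> : (m.+1 * n).+1 = (m * n).+1 + n by lia.
apply: halts_seq; apply: halts_weaken (leqnn _) _ (IH _ inv0).
  by move=> s' inv; apply: step.
by move=> j s' lt_j; apply: step; rewrite ltnS ltnW.
Qed.

End Rules.

(** * The program *)

Declare Scope expr_scope.
Delimit Scope expr_scope with X.
Bind Scope expr_scope with expr.
Notation "e1 + e2" := (Op Add e1 e2) : expr_scope.
Notation "e1 - e2" := (Op Defs.Sub e1 e2) : expr_scope.
Notation "e1 * e2" := (Op Mul e1 e2) : expr_scope.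
Notation "e1 / e2" := (Op Div e1 e2) : expr_scope.

Definition input_size : expr := Fetch (Lit 0).

(** The registers above the input are the work area, addressed relatively to the
    input size, which stays in register 0 until the end. *)
Definition work_reg (i : nat) : expr := (input_size + Lit i.+1)%X.

Definition radixE : expr := Fetch (work_reg 0).
Definition counter : expr := Fetch (work_reg 1).
Definition best_num : expr := Fetch (work_reg 2).
Definition best_den : expr := Fetch (work_reg 3).
Definition cell (e : expr) : expr := (work_reg 4 + e)%X.

(** Exponents and part numbers are known when the program is written, so powers
    and loops over the parts are unrolled. *)
Definition powE (e : expr) (k : nat) : expr := iter k (Op Mul e) (Lit 1).
Definition modE (e1 e2 : expr) : expr := (e1 - e1 / e2 * e2)%X.

Definition upto (hi : expr) (c : program) : program :=
  While (hi - counter)%X (Seq c (Store (work_reg 1) (counter + Lit 1)%X)).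

(** The data consist of two lists of the same length. *)
Definition itemsE : expr := (input_size / Lit 2)%X.

Definition compute_radix : program :=
  Seq (Store (work_reg 0) (Lit 1))
      (upto input_size
         (Store (work_reg 0) (radixE + Fetch (counter + Lit 1))%X)).

Section Program.
Variable m : nat.

(** Codes of assignments of the first [i] items fill the [i]-th layer, the interval
    from [i * W ^ (m + m)] on of length [W ^ (m + m)]. *)
Definition layerE : expr := powE radixE (m + m).
Definition itemE : expr := (counter / layerE)%X.

(** Item [i] has its numbers in registers [i + 1] and [n + i + 1]. *)
Definition stepE (j : nat) : expr :=
  (layerE + powE radixE j *
     (Fetch (itemE + Lit 1) + Fetch (itemsE + itemE + Lit 1) * powE radixE m))%X.

Definition fill_table : program :=
  Seq (Store (cell (Lit 0)) (Lit 1))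
  (Seq (Store (work_reg 1) (Lit 0))
       (upto (itemsE * layerE)%X
          (If (Fetch (cell counter))
              (seqs (fun j => Store (cell (counter + stepE j)%X) (Lit 1)) m)
              Skip))).

Definition digitE (j : nat) : expr := modE (counter / powE radixE j)%X radixE.

(** An empty part has sums 0 and 0; replacing the denominator 0 by 1 gives its
    ratio the conventional value 0 and makes cross-multiplication valid. *)
Definition denE (j : nat) : expr := (digitE (m + j) + (Lit 1 - digitE (m + j)))%X.

(** By truncation of the subtraction, nonzero exactly when [p / q < p' / q']. *)
Definition ltE (p q p' q' : expr) : expr := (p' * q - p * q')%X.

(** A product of truth values serves as a conjunction. *)
Definition smallestE (j : nat) : expr :=
  foldr (fun i e => (Lit 1 - ltE (digitE i) (denE i) (digitE j) (denE j)) * e)%X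
        (Lit 1) (iota 0 m).

Definition improvesE (j : nat) : expr :=
  (smallestE j * ltE best_num best_den (digitE j) (denE j))%X.

(** The counter is left by [fill_table] at the beginning of the last layer, and the
    initial candidate is the fraction 0 / 1. *)
Definition scan_last_layer : program :=
  Seq (Store (work_reg 3) (Lit 1))
      (upto (itemsE * layerE + layerE)%X
         (If (Fetch (cell counter))
             (seqs (fun j => If (improvesE j)
                                (Seq (Store (work_reg 2) (digitE j))
                                     (Store (work_reg 3) (denE j)))
                                Skip) m)
             Skip)).

(** Register 0 is overwritten last because the addresses of the work area depend
    on it. *)
Definition return_best : program :=
  Seq (Store (Lit 1) best_den) (Store (Lit 0) best_num).

Definition map_program : program :=
  Seq compute_radix (Seq fill_table (Seq scan_last_layer return_best)).

End Program.

(** * Memory layout *)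

(** These two lemmas take the place of simplification, which would expand the
   compound expressions along with the operation at the root. *)
Lemma evalF s e : eval s (Fetch e) = s (eval s e).
Proof. by []. Qed.

Lemma evalO s o e1 e2 : eval s (Op o e1 e2) = eval_op o (eval s e1) (eval s e2).
Proof. by []. Qed.

(** Memories are described extensionally by their input part and their work area,
    so that a store becomes an equality between memories of this form. *)
Definition mem (l : seq nat) (f : memory) : memory :=
  fun i => if i <= size l then init_memory l i else f (i - (size l).+1).

Definition work (W k p q : nat) (T : pred nat) : memory := fun i =>
  match i with 0 => W | 1 => k | 2 => p | 3 => q | y.+4 => T y end.

Section Layout.
Variable l : seq nat.
Implicit Types (f : memory) (W k p q : nat) (T : pred nat).

Lemma init_mem : init_memory l = mem l (work 0 0 0 0 pred0).
Proof.
apply: functional_extensionality => i; rewrite /mem /init_memory.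
case: leqP => // lt_i; rewrite nth_default //.
by case: (i - _) => [|[|[|[]]]].
Qed.

Lemma mem_input f i : i < size l -> mem l f i.+1 = nth 0 l i.
Proof. by rewrite /mem /init_memory => ->. Qed.

Lemma mem_work f i : mem l f (size l + i.+1) = f i.
Proof. by rewrite /mem addnS ltnNge leq_addr subSS addKn. Qed.

Lemma store_mem f i v : store (mem l f) (size l + i.+1) v = mem l (store f i v).
Proof.
apply: functional_extensionality => x; rewrite /store /mem.
case: eqVneq => [->|ne].
  by rewrite addnS ltnNge leq_addr /= subSS addKn eqxx.
case: leqP => // lt_x; case: eqVneq => // e; case/eqP: ne; lia.
Qed.

Lemma store_radix W k p q T v :
  store (work W k p q T) 0 v = work v k p q T.
Proof. by apply: functional_extensionality; do 4?[case=> //]. Qed.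

Lemma store_counter W k p q T v :
  store (work W k p q T) 1 v = work W v p q T.
Proof. by apply: functional_extensionality; do 4?[case=> //]. Qed.

Lemma store_best_num W k p q T v :
  store (work W k p q T) 2 v = work W k v q T.
Proof. by apply: functional_extensionality; do 4?[case=> //]. Qed.

Lemma store_best_den W k p q T v :
  store (work W k p q T) 3 v = work W k p v T.
Proof. by apply: functional_extensionality; do 4?[case=> //]. Qed.

Lemma store_cell W k p q T y :
  store (work W k p q T) y.+4 1 = work W k p q (predU1 y T).
Proof.
apply: functional_extensionality; do 4?[case=> //].
by move=> x; rewrite /store /= !eqSS; case: eqP.
Qed.

Lemma eval_work_reg f i : eval (mem l f) (work_reg i) = size l + i.+1.
Proof. by []. Qed.

Lemma eval_radix W k p q T : eval (mem l (work W k p q T)) radixE = W.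
Proof. exact: mem_work. Qed.

Lemma eval_counter W k p q T : eval (mem l (work W k p q T)) counter = k.
Proof. exact: mem_work. Qed.

Lemma eval_best_num W k p q T : eval (mem l (work W k p q T)) best_num = p.
Proof. exact: mem_work. Qed.

Lemma eval_best_den W k p q T : eval (mem l (work W k p q T)) best_den = q.
Proof. exact: mem_work. Qed.

Lemma eval_cell f e :
  eval (mem l f) (cell e) = size l + (eval (mem l f) e).+4.+1.
Proof. by rewrite [LHS]/(size l + 5 + eval (mem l f) e); lia. Qed.

Lemma eval_fetch_cell W k p q T e :
  eval (mem l (work W k p q T)) (Fetch (cell e))
  = T (eval (mem l (work W k p q T)) e).
Proof. by rewrite evalF eval_cell mem_work. Qed.

Lemma eval_pow s e k : eval s (powE e k) = eval s e ^ k.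
Proof. by elim: k => // k IH; rewrite expnS -IH. Qed.

Lemma eval_mod s e1 e2 : eval s (modE e1 e2) = eval s e1 %% eval s e2.
Proof. by rewrite /modE !evalO /= {1}(divn_eq (eval s e1) (eval s e2)) addKn. Qed.

End Layout.

(** * What each phase computes *)

Section Phases.
Variables (V n : nat) (l : seq nat).
Hypothesis size_l : size l = n + n.

Notation conf W k p q T := (mem l (work W k p q T)).

(** The counter is kept apart from the other work registers because invariants of
    loops are indexed by its value. *)
Inductive at_counter (P : nat -> nat -> nat -> pred nat -> Prop) k s : Prop :=
  AtCounter W p q T of s = conf W k p q T & P W p q T.

(** The body does not touch the counter, and establishes the invariant for the
    value that the counter has after the increment. *)
Lemma halts_upto (Inv : nat -> nat -> nat -> nat -> pred nat -> Prop)
    e c d lo hi s : hi <= V -> lo <= hi ->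
  (forall k W p q T, Inv k W p q T -> eval (conf W k p q T) e = hi) ->
  (forall k W p q T, k < hi -> Inv k W p q T ->
     halts V c (conf W k p q T) d (at_counter (Inv k.+1) k)) ->
  at_counter (Inv lo) lo s ->
  halts V (upto e c) s ((hi - lo) * d.+3).+1 (at_counter (Inv hi) hi).
Proof.
move=> hiV lo_hi ehi body inv_lo.
have test k W p q T : Inv k W p q T ->
    eval (conf W k p q T) (e - counter)%X = hi - k.
  by move=> inv; rewrite evalO (ehi _ _ _ _ _ inv) eval_counter.
apply: (@halts_while V _ _ d.+2 (fun k => at_counter (Inv k) k)) => //.
- by move=> _ [W p q T -> inv]; rewrite (test _ _ _ _ _ inv) subnn.
- by move=> k _ lt_k [W p q T -> inv]; rewrite (test _ _ _ _ _ inv) -lt0n subn_gt0.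
move=> k _ lt_k [W p q T -> inv]; rewrite -addn2; apply: halts_seq.
apply: halts_weaken (leqnn _) _ (body _ _ _ _ _ lt_k inv).
move=> _ [W' p' q' T' -> inv'].
have ek : eval (conf W' k p' q' T') (counter + Lit 1)%X = k.+1.
  by rewrite evalO eval_counter /= addn1.
apply: halts_store; first by rewrite ek (leq_trans lt_k).
by rewrite ek eval_work_reg store_mem store_counter; exists W' p' q' T'.
Qed.

Lemma halts_compute_radix : (sumn l).+1 <= V -> n + n <= V ->
  halts V compute_radix (init_memory l) (2 + ((n + n) * 5).+1)
    (at_counter (fun W p q T => [/\ W = (sumn l).+1, p = 0, q = 0 & T = pred0])
       (n + n)).
Proof.
move=> sumV nV; rewrite init_mem -size_l.
pose Inv k W p q T := [/\ W = (sumn (take k l)).+1, p = 0, q = 0 & T = pred0 :> pred nat].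
have sum_take k : (sumn (take k l)).+1 <= V.
  by apply: leq_trans sumV; rewrite -{2}(cat_take_drop k l) sumn_cat ltnS leq_addr.
apply: halts_seq.
apply: halts_store; first exact: leq_trans sumV.
rewrite eval_work_reg store_mem store_radix.
apply: halts_weaken (_ : _ <= _) _ (@halts_upto Inv _ _ 2 0 (size l) _ _ _ _ _ _).
- by rewrite subn0.
- by move=> s' []; rewrite /Inv take_size => W p q T -> ?; exists W p q T.
- by rewrite size_l.
- by [].
- by [].
- move=> k _ _ _ _ lt_k [-> -> -> ->].
  have ev : eval (conf (sumn (take k l)).+1 k 0 0 pred0)
                 (radixE + Fetch (counter + Lit 1))%X = (sumn (take k.+1 l)).+1.
    rewrite evalO evalF evalO eval_radix eval_counter /= addn1 mem_input //.
    by rewrite (take_nth 0) // sumn_rcons.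
  apply: halts_store; rewrite ev //.
  by rewrite eval_work_reg store_mem store_radix; exists (sumn (take k.+1 l)).+1 0 0 pred0.
- by exists 1 0 0 pred0 => //; rewrite /Inv take0.
Qed.

Variables (W m : nat).
Hypothesis W_gt0 : 0 < W.
Let N := W ^ (m + m).
Hypothesis capacity : n * N + N <= V.

Lemma eval_layer k p q T : eval (conf W k p q T) (layerE m) = N.
Proof. by rewrite eval_pow eval_radix. Qed.

Lemma eval_items f : eval (mem l f) itemsE = n.
Proof.
by transitivity (size l %/ 2) => //; rewrite size_l divn2 addnn doubleK.
Qed.

(** The code of an assignment grows by this amount, which depends on the code only
    through the number of items placed, when the next item goes to part [j]. *)
Definition code_move (y j : nat) : nat :=
  N + W ^ j * (nth 0 l (y %/ N) + nth 0 l (n + y %/ N) * W ^ m).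

Let N_gt0 : 0 < N.
Proof. by rewrite expn_gt0 W_gt0. Qed.

Lemma code_move_gt0 y j : 0 < code_move y j.
Proof. by rewrite addn_gt0 N_gt0. Qed.

Lemma eval_code_move k p q T j : k < n * N ->
  eval (conf W k p q T) (stepE m j) = code_move k j.
Proof.
rewrite -ltn_divLR ?N_gt0 // => lt_n; set s := mem l _.
transitivity (eval s (layerE m) + eval s (powE radixE j) *
  (s (eval s (itemE m) + 1) +
   s (eval s itemsE + eval s (itemE m) + 1) * eval s (powE radixE m))) => //.
have -> : eval s (itemE m) = k %/ N by rewrite evalO eval_counter eval_layer.
rewrite eval_layer !eval_pow eval_radix eval_items !addn1.
rewrite /code_move; move: (k %/ N) lt_n => i lt_n.
have lt1 : i < size l by rewrite size_l ltn_addr.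
have lt2 : n + i < size l by rewrite size_l ltn_add2l.
by rewrite /s (mem_input _ lt1) (mem_input _ lt2).
Qed.

(** What is known of the table once the counter has reached [hi]. *)
Definition closed_below hi (T : pred nat) :=
  forall y, y < hi -> T y -> forall j, j < m -> T (y + code_move y j).

(** Moves are strictly increasing, so marks made while the counter is at [k] lie
    above [k]: no code is marked after it has been processed, and one pass in
    increasing order closes the table. *)
Lemma halts_fill_table (reach : nat -> Prop) s :
  reach 0 -> (forall y j, y < n * N -> j < m -> reach y -> reach (y + code_move y j)) ->
  at_counter (fun W' p q T => [/\ W' = W, p = 0, q = 0 & T = pred0]) (n + n) s ->
  halts V (fill_table m) s (2 + (2 + (n * N * (m * 2).+2.+3).+1))
    (at_counter (fun W' p q T => [/\ W' = W, p = 0, q = 0 &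
        [/\ T 0, forall y, T y -> reach y & closed_below (n * N) T]]) (n * N)).
Proof.
move=> reach0 reachS [_ _ _ _ -> [-> -> -> ->]].
pose ok k (T : pred nat) := [/\ T 0, forall y, T y -> reach y & closed_below k T].
pose Inv k W' p q T := [/\ W' = W, p = 0, q = 0 & ok k T].
have V_gt0 : 0 < V by apply: leq_trans capacity; rewrite addn_gt0 N_gt0 orbT.
apply: halts_seq; apply: halts_store => //.
rewrite eval_cell store_mem store_cell.
apply: halts_seq; apply: halts_store => //.
rewrite eval_work_reg store_mem store_counter.
apply: halts_weaken (_ : _ <= _) _
  (@halts_upto Inv _ _ (m * 2).+2 0 (n * N) _ _ _ _ _ _) => //.
- by rewrite subn0.
- by apply: leq_trans capacity; rewrite leq_addr.
- by move=> k _ p q T [-> _ _ _]; rewrite evalO eval_items eval_layer.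
- move=> k _ _ _ T lt_k [-> -> -> [T0 sound closed]].
  apply: halts_if; rewrite eval_fetch_cell eval_counter.
    case: (boolP (T k)) => // Tk _.
    (* [T' k] is carried along because it makes the codes marked next reachable. *)
    pose InvJ j s' := exists T' : pred nat, [/\ s' = conf W k 0 0 T',
      T' 0, forall y, T' y -> reach y, closed_below k T' &
      T' k /\ forall i, i < j -> T' (k + code_move k i)].
    apply: halts_weaken (leqnn _) _ (@halts_seqs _ _ _ InvJ _ _ _ _).
    + move=> _ [T' [-> T'0 sound' closed' [T'k doneT]]].
      exists W 0 0 T' => //; split=> //; split=> // y.
      by rewrite ltnS leq_eqVlt => /predU1P[->|/closed'] //.
    + move=> j _ lt_j [T' [-> T'0 sound' closed' [T'k doneT]]].
      have ev : eval (conf W k 0 0 T') (counter + stepE m j)%X = k + code_move k j.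
        by rewrite evalO eval_counter eval_code_move.
      apply: halts_store => //; rewrite eval_cell ev store_mem store_cell.
      have far y : y <= k -> (y == k + code_move k j) = false.
        by move=> le_y; have := code_move_gt0 k j; lia.
      exists (predU1 (k + code_move k j) T'); split=> //=.
      * by rewrite T'0 orbT.
      * by move=> y /predU1P[->|/sound'] //; apply: reachS lt_k lt_j (sound' _ T'k).
      * move=> y lt_y; rewrite /= far 1?ltnW //= => T'y i lt_i.
        by rewrite closed' ?orbT.
      split; first by rewrite T'k orbT.
      move=> i; rewrite ltnS leq_eqVlt => /predU1P[->|/doneT ->]; last by rewrite orbT.
      by rewrite eqxx.
    + by exists T.
  case: (boolP (T k)) => // nTk _; apply: halts_skip.
  exists W 0 0 T => //; split=> //; split=> // y.
  by rewrite ltnS leq_eqVlt => /predU1P[->|/closed] //; rewrite (negbTE nTk).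
exists W 0 0 (predU1 0 pred0) => //; split=> //; split=> //.
by move=> y; rewrite /= orbF => /eqP->.
Qed.

(** * Comparing ratios *)

Definition digit y j := (y %/ W ^ j) %% W.
Definition part_den y j := digit y (m + j) + (1 - digit y (m + j)).
Definition ratio y j : rat := ((digit y j)%:R / (part_den y j)%:R)%R.

Lemma part_den_gt0 y j : 0 < part_den y j.
Proof. by rewrite /part_den; lia. Qed.

Lemma digit_le y j : digit y j <= W.
Proof. by rewrite ltnW // ltn_mod. Qed.

Lemma part_den_le y j : part_den y j <= W.
Proof.
have : digit y (m + j) < W by rewrite ltn_mod.
by rewrite /part_den; lia.
Qed.

Lemma ltr_fraction (p q p' q' : nat) : 0 < q -> 0 < q' ->
  (p%:R / q%:R < p'%:R / q'%:R :> rat)%R = (p * q' < p' * q).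
Proof.
move=> q0 q'0; rewrite ltr_pdivrMr ?ltr0n // mulrAC ltr_pdivlMr ?ltr0n //.
by rewrite -!natrM ltr_nat.
Qed.

Lemma eval_lt s e1 e2 e3 e4 : (eval s (ltE e1 e2 e3 e4) != 0)
  = (eval s e1 * eval s e4 < eval s e3 * eval s e2).
Proof. by rewrite /ltE !evalO /= -lt0n subn_gt0. Qed.

Section Evaluation.
Variables (k p q : nat) (T : pred nat).
Let s := conf W k p q T.

Lemma eval_digit j : eval s (digitE j) = digit k j.
Proof. by rewrite eval_mod evalO eval_pow eval_counter eval_radix. Qed.

Lemma eval_den j : eval s (denE m j) = part_den k j.
Proof. by rewrite /part_den -!eval_digit. Qed.

Lemma eval_smallest j : reflect (forall i, i < m -> (ratio k j <= ratio k i)%R)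
  (eval s (smallestE m j) != 0).
Proof.
pose e i := ltE (digitE i) (denE m i) (digitE j) (denE m j).
have eE i : (1 - eval s (e i) != 0) = (ratio k j <= ratio k i)%R.
  rewrite leNgt ltr_fraction ?part_den_gt0 //.
  have := eval_lt s (digitE i) (denE m i) (digitE j) (denE m j).
  by rewrite !eval_digit !eval_den => <-; rewrite /e; case: (eval s _).
have -> : (eval s (smallestE m j) != 0)
    = all (fun i => ratio k j <= ratio k i)%R (iota 0 m).
  rewrite /smallestE; elim: (iota 0 m) => // i r IH.
  rewrite [RHS]/= -IH -eE -negb_or -muln_eq0 //.
apply: (iffP allP) => h i; first by move=> lt_i; apply: h; rewrite mem_iota.
by rewrite mem_iota => /h.
Qed.

Lemma eval_improves j : 0 < q -> reflect
  ((forall i, i < m -> (ratio k j <= ratio k i)%R) /\ (p%:R / q%:R < ratio k j)%R)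
  (eval s (improvesE m j) != 0).
Proof.
move=> q0; rewrite /improvesE evalO muln_eq0 negb_or.
have -> : (eval s (ltE best_num best_den (digitE j) (denE m j)) != 0)
    = (p%:R / q%:R < ratio k j)%R.
  rewrite eval_lt ltr_fraction ?part_den_gt0 //.
  by rewrite eval_digit eval_den eval_best_num eval_best_den.
by apply: (iffP andP) => -[/eval_smallest h1 h2].
Qed.

End Evaluation.

(** Every code thus has a part that can become the candidate, unless the candidate
    is already as large. *)
Lemma smallest_ratio y : 0 < m ->
  exists2 j, j < m & forall i, i < m -> (ratio y j <= ratio y i)%R.
Proof.
move=> m0; case: (@arg_minP _ _ _ (Ordinal m0) xpredT (ratio y)) => // j _ le_j.
by exists j => // i lt_i; apply: (le_j (Ordinal lt_i)).
Qed.

(** For [hi] at the end of the last layer, this says that [v] is the largest of the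
    minimal ratios. Attainment is stated as an inequality so that it also holds
    initially, for [v = 0] and any code of the layer. *)
Definition best_below (T : pred nat) hi (v : rat) :=
  (exists2 y, n * N <= y < n * N + N /\ T y & forall j, j < m -> (v <= ratio y j)%R) /\
  (forall y, n * N <= y < hi -> T y -> exists2 j, j < m & (ratio y j <= v)%R).

(** The table is only read here, so any property [P] of it survives. *)
Lemma halts_scan_last_layer (P : pred nat -> Prop) s : 0 < m ->
  (forall T, P T -> exists2 y, n * N <= y < n * N + N & T y) ->
  at_counter (fun W' p q T => [/\ W' = W, p = 0, q = 0 & P T]) (n * N) s ->
  halts V (scan_last_layer m) s (2 + (N * (m * 5).+2.+3).+1)
    (at_counter (fun W' p q T => [/\ 0 < q, P T &
        best_below T (n * N + N) (p%:R / q%:R)%R]) (n * N + N)).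
Proof.
move=> m0 exT [_ _ _ T -> [-> -> -> PT]].
pose Inv k W' p q T' := [/\ W' = W, 0 < q, T' = T &
  n * N <= k /\ best_below T k (p%:R / q%:R)%R].
have N_V : N <= V by apply: leq_trans capacity; rewrite leq_addl.
have W_N : W <= N by rewrite -{1}(expn1 W) leq_pexp2l // addn_gt0 m0.
have W_V : W <= V := leq_trans W_N N_V.
apply: halts_seq; apply: halts_store; first exact: leq_trans W_V.
rewrite eval_work_reg store_mem store_best_den.
apply: halts_weaken (_ : _ <= _) _
  (@halts_upto Inv _ _ (m * 5).+2 (n * N) (n * N + N) _ _ _ _ _ _) => //.
- by rewrite addKn.
- by move=> s' [W' p q T' -> [-> q0 -> [_ best]]]; exists W p q T.
- by rewrite leq_addr.
- by move=> k _ p q T' [-> _ _ _]; rewrite 2!evalO eval_items eval_layer.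
- move=> k _ p q _ lt_k [-> q0 -> [le_k [sound complete]]].
  apply: halts_if; rewrite eval_fetch_cell eval_counter.
    case: (boolP (T k)) => // Tk _.
    (* Only a part that attains the minimal ratio of [k] may replace the candidate,
       so nothing is claimed about the other parts. *)
    pose InvJ j s' := exists p' q', [/\ s' = conf W k p' q' T, 0 < q',
      best_below T k (p'%:R / q'%:R)%R &
      forall j', j' < j -> (forall i, i < m -> (ratio k j' <= ratio k i)%R) ->
        (ratio k j' <= p'%:R / q'%:R)%R].
    apply: halts_weaken (_ : (m * 5).+1 <= _) _ (@halts_seqs _ _ 5 InvJ _ _ _ _) => //.
    + move=> _ [p' [q' [-> q'0 [sound' complete'] min']]].
      exists W p' q' T => //; split=> //; split; first exact: leqW.
      split=> // y.
      rewrite ltnS [y <= k]leq_eqVlt => /andP[le_y /predU1P[->|lt_y]] Ty; last first.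
        by apply: complete'; rewrite ?le_y.
      by have [j lt_j le_j] := smallest_ratio k m0; exists j; rewrite ?min'.
    + move=> j _ lt_j [p' [q' [-> q'0 [sound' complete'] min']]].
      apply: halts_if.
        move/eval_improves => /(_ q'0)[minj ltj].
        apply: (@halts_seq _ _ _ _ 2 2); apply: halts_store.
          by rewrite eval_digit (leq_trans (digit_le _ _)).
        rewrite eval_digit eval_work_reg store_mem store_best_num.
        apply: halts_store.
          by rewrite eval_den (leq_trans (part_den_le _ _)).
        rewrite eval_den eval_work_reg store_mem store_best_den.
        exists (digit k j), (part_den k j); split=> //.
        * exact: part_den_gt0.
        * split; first by exists k; rewrite ?le_k.
          move=> y lt_y Ty; have [i lt_i le_i] := complete' y lt_y Ty.
          by exists i => //; apply: le_trans le_i (ltW ltj).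
        * by move=> i _ /(_ j lt_j).
      move=> /eqP worse; apply: halts_skip.
      exists p', q'; split=> //.
      move=> i; rewrite ltnS leq_eqVlt => /predU1P[->|/min'//] mini.
      by rewrite leNgt; apply: contraL worse => lt; apply/eval_improves.
    + by exists p, q.
  case: (boolP (T k)) => // nTk _; apply: halts_skip.
  exists W p q T => //; split=> //; split; first exact: leqW.
  split=> // y.
  rewrite ltnS [y <= k]leq_eqVlt => /andP[le_y /predU1P[->|lt_y]].
    by rewrite (negbTE nTk).
  by apply: complete; rewrite le_y.
exists W 0 1 T => //; split=> //; split=> //; split; last first.
  by move=> y /andP[h1 h2]; have := leq_ltn_trans h1 h2; rewrite ltnn.
have [y ly Ty] := exT _ PT; exists y => // j _.
by rewrite mul0r divr_ge0 ?ler0n.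
Qed.

Lemma halts_return_best (P : nat -> nat -> nat -> pred nat -> Prop) k s :
  at_counter P k s -> halts V return_best s 4
    (fun s' => exists W' T, P W' (s' 0) (s' 1) T).
Proof.
move=> [W' p q T -> PW] bs.
have pV : p <= V by have := bs (size l + 3); rewrite mem_work.
have qV : q <= V by have := bs (size l + 4); rewrite mem_work.
apply: (@halts_seq V _ _ _ 2 2) bs; apply: halts_store; rewrite eval_best_den //=.
set s1 := store _ _ _.
have ev : eval s1 best_num = p.
  transitivity (s1 (size l + 3)) => //.
  by rewrite /s1 /store (_ : (size l + 3 == _) = false) ?mem_work //= addn3.
by apply: halts_store; rewrite ev //=; exists W', T; rewrite /store /=.
Qed.

End Phases.

(** * Codes of partial partitions *)

Section Digits.
Variables (W : nat) (v : nat -> nat).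
Hypothesis v_lt : forall k, v k < W.

(** [h] is an arbitrary number, not a digit: everything from position [K] on. *)
Lemma div_digits K h : (\sum_(k < K) v k * W ^ k + h * W ^ K) %/ W ^ K = h.
Proof.
have W0 : 0 < W := leq_ltn_trans (leq0n _) (v_lt 0).
elim: K h => [|K IH] h; first by rewrite big_ord0 expn0 muln1 divn1.
rewrite big_ord_recr /= -addnA expnSr.
have -> : v K * W ^ K + h * (W ^ K * W) = (v K + h * W) * W ^ K by lia.
by rewrite divnMA IH addnC divnMDl // divn_small ?addn0.
Qed.

Lemma nth_digit K h j : j < K ->
  (\sum_(k < K) v k * W ^ k + h * W ^ K) %/ W ^ j %% W = v j.
Proof.
elim: K h => // K IH h; rewrite big_ord_recr /= -addnA expnSr.
have -> : v K * W ^ K + h * (W ^ K * W) = (v K + h * W) * W ^ K by lia.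
rewrite ltnS leq_eqVlt => /predU1P[->|]; last exact: IH.
by rewrite div_digits addnC modnMDl modn_small.
Qed.

End Digits.

Section Codes.
Variables (n m : nat) (l : seq nat).
Hypothesis size_l : size l = n + n.
Implicit Types g : nat -> 'I_m.

Let W := (sumn l).+1.
Let N := W ^ (m + m).

(** Written as a sum over the items, which is the form that grows by one move when
    an item is added; [code_digits] gives the positional form. *)
Definition code i g :=
  \sum_(k < i) W ^ g k * (nth 0 l k + nth 0 l (n + k) * W ^ m).

Definition part_sum off i g j :=
  \sum_(k < i | g k == j :> nat) nth 0 l (off + k).

Definition code_digit i g k :=
  if k < m then part_sum 0 i g k else part_sum n i g (k - m).

Lemma sum_by_part off i g :
  \sum_(k < i) nth 0 l (off + k) * W ^ g k = \sum_(j < m) part_sum off i g j * W ^ j.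
Proof.
rewrite (partition_big (fun k : 'I_i => g k) xpredT) //=.
apply: eq_bigr => j _; rewrite /part_sum big_distrl /=.
by apply: eq_bigr => k /eqP->.
Qed.

Lemma code_digits i g : code i g = \sum_(k < m + m) code_digit i g k * W ^ k.
Proof.
rewrite big_split_ord /=.
rewrite (eq_bigr (fun j : 'I_m => part_sum 0 i g j * W ^ j)); last first.
  by move=> j _; rewrite /code_digit ltn_ord.
rewrite [X in _ + X](eq_bigr (fun j : 'I_m => part_sum n i g j * W ^ j * W ^ m)); last first.
  by move=> j _; rewrite /code_digit ltnNge leq_addr addKn expnD (mulnC (W ^ m)) mulnA.
rewrite -big_distrl /= -!sum_by_part big_distrl -big_split /=.
by apply: eq_bigr => k _; rewrite mulnDr add0n mulnA !(mulnC (W ^ g k)).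
Qed.

Lemma code_digit_lt i g k : i <= n -> code_digit i g k < W.
Proof.
move=> le_n.
suff h off j : off = 0 \/ off = n -> part_sum off i g j < W.
  by rewrite /code_digit; case: ifP => _; apply: h; [left | right].
move=> off_eq; rewrite ltnS /part_sum.
apply: (@leq_trans (\sum_(k < i) nth 0 l (off + k))).
  by rewrite [leqRHS](bigID (fun k : 'I_i => g k == j :> nat)) /= leq_addr.
apply: (@leq_trans (\sum_(k < n) nth 0 l (off + k))).
  rewrite -(subnKC le_n) big_split_ord /= leq_addr //.
rewrite sumnE (big_nth 0) size_l big_mkord big_split_ord /=.
by case: off_eq => ->; rewrite ?leq_addl // leq_addr.
Qed.

Lemma layer_code i g : i <= n -> (i * N + code i g) %/ N = i.
Proof.
move=> le_n; rewrite code_digits addnC.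
by apply: div_digits => k; apply: code_digit_lt.
Qed.

Lemma digit_code i g j : i <= n -> j < m + m ->
  digit W (i * N + code i g) j = code_digit i g j.
Proof.
move=> le_n; rewrite code_digits addnC /digit.
by apply: nth_digit => k; apply: code_digit_lt.
Qed.

(** Layers are disjoint, so the layer of a code tells how many items it has
    placed. *)
Definition reachable y := exists i g, i <= n /\ y = i * N + code i g.

Let N_gt0 : 0 < N.
Proof. by rewrite expn_gt0. Qed.

Lemma code_recr i g :
  i.+1 * N + code i.+1 g =
  i * N + code i g + (N + W ^ g i * (nth 0 l i + nth 0 l (n + i) * W ^ m)).
Proof. by rewrite /code big_ord_recr /= mulSn; lia. Qed.

Lemma reachable0 : 0 < m -> reachable 0.
Proof.
by move=> m0; exists 0, (fun=> Ordinal m0); rewrite /code big_ord0.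
Qed.

Lemma reachableS y j : y < n * N -> j < m -> reachable y ->
  reachable (y + code_move n l W m y j).
Proof.
move=> lt_y lt_j [i [g [le_i def_y]]].
have yN : y %/ N = i by rewrite def_y layer_code.
have lt_i : i < n by rewrite -yN ltn_divLR ?N_gt0.
pose g' k := if k == i then Ordinal lt_j else g k.
exists i.+1, g'; split=> //; rewrite code_recr /code_move -/N yN /g' eqxx /= {1}def_y.
congr (_ + _ + _); apply: eq_bigr => k _.
by rewrite ltn_eqF.
Qed.

Lemma closed_reachable (T : pred nat) i g :
  T 0 -> closed_below n l W m (n * N) T -> i <= n -> T (i * N + code i g).
Proof.
move=> T0 closed; elim: i => [|i IH] lt_i; first by rewrite /code big_ord0.
have yN := layer_code g (ltnW lt_i).
have := closed _ _ (IH (ltnW lt_i)) (g i) (ltn_ord _).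
rewrite code_recr /code_move -/N yN; apply.
by rewrite -ltn_divLR ?N_gt0 // yN.
Qed.

Lemma code_last_layer g : n * N <= n * N + code n g < n * N + N.
Proof.
rewrite leq_addr /= -mulSnr -ltn_divLR ?N_gt0 //.
by rewrite layer_code.
Qed.

Lemma reachable_last_layer y : reachable y -> n * N <= y < n * N + N ->
  exists g, y = n * N + code n g.
Proof.
move=> [i [g [le_i def_y]]]; rewrite -mulSnr -ltn_divLR ?N_gt0 // -leq_divRL ?N_gt0 //.
rewrite {1 2}def_y layer_code // => /andP[le_n _].
by exists g; rewrite def_y; congr (_ * _ + code _ _); apply/eqP; rewrite eqn_leq le_i.
Qed.

End Codes.

(** * From codes to partitions *)

Lemma min_seq_le (r : seq rat) v : v \in r -> (min_seq r <= v)%R.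
Proof.
rewrite /min_seq; move: (head 0%R r) => d; elim: r => // u r IH.
rewrite big_cons ge_min inE => /predU1P[->|/IH ->]; first by rewrite lexx.
by rewrite orbT.
Qed.

Lemma le_min_seq (r : seq rat) v :
  r != [::] -> (forall u, u \in r -> (v <= u)%R) -> (v <= min_seq r)%R.
Proof.
move=> r0 le_v; rewrite /min_seq.
have : (v <= head 0%R r)%R.
  by apply: le_v; case: r r0 => // u r _; rewrite inE eqxx.
move: (head 0%R r) => d le_d; elim: r le_v {r0} => [|u r IH] le_v; first by rewrite big_nil.
rewrite big_cons le_min le_v ?inE ?eqxx //=.
by apply: IH => w w_r; rewrite le_v // inE w_r orbT.
Qed.

Section Instance.
Variables (m : nat) (x : map_instance).
Let n := items x.
Let l : seq nat := nums x ++ dens x.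

Lemma size_data : size l = n + n.
Proof. by rewrite size_cat !size_tuple. Qed.

Lemma nth_nums (i : 'I_n) : nth 0 l i = tnth (nums x) i.
Proof. by rewrite nth_cat size_tuple ltn_ord -tnth_nth. Qed.

Lemma nth_dens (i : 'I_n) : nth 0 l (n + i) = tnth (dens x) i.
Proof. by rewrite nth_cat size_tuple ltnNge leq_addr addKn -tnth_nth. Qed.

Definition part_of (g : nat -> 'I_m) (j : 'I_m) : {set 'I_n} := [set i : 'I_n | g i == j].

Lemma part_of_partition g : is_partition (part_of g).
Proof.
split=> [j k|].
  apply: contraR => /pred0Pn[i /=]; rewrite !inE => /andP[/eqP<- /eqP<-].
  exact: eqxx.
by apply/setP=> i; rewrite inE; apply/bigcupP; exists (g i) => //; rewrite inE.
Qed.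

Lemma partition_part_of (I : 'I_m -> {set 'I_n}) :
  is_partition I -> exists g, forall j, I j = part_of g j.
Proof.
move=> [disj cov].
have in_I (i : 'I_n) : exists j, i \in I j.
  have: i \in [set: 'I_n] by rewrite inE.
  by rewrite -cov => /bigcupP[j _ ?]; exists j.
pose g i := xchoose (in_I (insubd (Ordinal (items_gt0 x)) i)).
have gP (i : 'I_n) : i \in I (g i).
  by rewrite /g valKd; apply: (xchooseP (in_I i)).
exists g => j; apply/setP=> i; rewrite inE; apply/idP/eqP => [ij|<-]; last exact: gP.
apply/eqP; apply: contraTT ij => /disj dis.
by have := disjointFr dis (gP i) => ->.
Qed.

Lemma part_sum_num g (j : 'I_m) :
  part_sum l 0 n g j = \sum_(i in part_of g j) tnth (nums x) i.
Proof. by apply: eq_big => [i|i _]; rewrite ?inE // nth_nums. Qed.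

Lemma part_sum_den g (j : 'I_m) :
  part_sum l n n g j = \sum_(i in part_of g j) tnth (dens x) i.
Proof. by apply: eq_big => [i|i _]; rewrite ?inE // nth_dens. Qed.

Let W := (sumn l).+1.
Let N := W ^ (m + m).

(** A nonempty part has a positive denominator, to which nothing is added; for an
    empty part both fractions are 0. *)
Lemma ratio_code g (j : 'I_m) :
  ratio W m (n * N + code n l n g) j = part_ratio (part_of g j).
Proof.
rewrite /ratio /part_den !(digit_code size_data) //; last 2 first.
- by rewrite ltn_add2l.
- exact: ltn_addr.
rewrite /code_digit ltn_ord ltnNge leq_addr addKn /=.
rewrite part_sum_num part_sum_den /part_ratio.
have [empty|/set0Pn[i i_in]] := eqVneq (part_of g j) set0.
  by rewrite empty !big_set0 !mul0r.
rewrite (_ : 1 - _ = 0) ?addn0 //; apply/eqP; rewrite subn_eq0.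
by rewrite (bigD1 i) //= ltn_addr // dens_gt0.
Qed.

Hypothesis m_gt0 : 0 < m.

Lemma best_is_optimum (T : pred nat) v :
  T 0 -> (forall y, T y -> reachable n m l y) ->
  closed_below n l W m (n * N) T ->
  best_below n W m T (n * N + N) v ->
  is_map_optimum m x v.
Proof.
move=> T0 sound closed [[y [ly Ty] le_v] complete].
have optimal (I : 'I_m -> {set 'I_n}) : is_partition I -> (min_ratio I <= v)%R.
  move=> /partition_part_of[g gI].
  have Tc := closed_reachable size_data g T0 closed (leqnn n).
  have [j lt_j le_j] := complete _ (code_last_layer size_data g) Tc.
  apply: le_trans le_j; rewrite -[j]/(val (Ordinal lt_j)) ratio_code -gI.
  by apply: min_seq_le; apply: map_f; rewrite mem_enum.
split=> //.
have [g def_y] := reachable_last_layer size_data (sound _ Ty) ly.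
exists (part_of g); split; first exact: part_of_partition.
apply/eqP; rewrite eq_le optimal /=; last exact: part_of_partition.
apply: le_min_seq => [|_ /mapP[j _ ->]].
  by rewrite -size_eq0 size_map size_enum_ord -lt0n.
by rewrite -ratio_code -def_y le_v.
Qed.

(** * Correctness and running time *)

(** Bounds all registers throughout: it is the end of the last layer, where the
    counter stops. *)
Definition register_bound := n * N + N.

Lemma sum_data_gt0 : 0 < sumn l.
Proof.
rewrite sumn_cat ltn_addl // sumnE big_tuple.
by rewrite (bigD1 (Ordinal (items_gt0 x))) //= ltn_addr // dens_gt0.
Qed.

Lemma map_program_correct : exists t s,
  [/\ exec (map_program m) (init_memory l) t s,
      t <= (5 * m + 25) * (register_bound + 2) ^ (cost_exp (map_program m)).+1,
      s 1 != 0 & is_map_optimum m x (output s)].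
Proof.
have W_gt1 : 1 < W by rewrite ltnS sum_data_gt0.
have W_gt0 : 0 < W by [].
have W_N : W <= N by rewrite -{1}(expn1 W) leq_pexp2l // addn_gt0 m_gt0.
have N_V : N <= register_bound by rewrite leq_addl.
have size_V : n + n <= register_bound by rewrite /register_bound; nia.
have sum_V : (sumn l).+1 <= register_bound by apply: leq_trans N_V.
have bnd : bounded register_bound (init_memory l).
  move=> [|i]; rewrite /init_memory /= ?size_data //.
  have [lt_i|le_i] := ltnP i (size l); last by rewrite nth_default.
  apply: leq_trans sum_V; rewrite leqW // sumnE (big_nth 0) big_mkord.
  by rewrite (bigD1 (Ordinal lt_i)) //= leq_addr.
pose ok (T : pred nat) := [/\ T 0, forall y, T y -> reachable n m l y
  & closed_below n l W m (n * N) T].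
have okP T : ok T -> exists2 y, n * N <= y < n * N + N & T y.
  move=> [T0 _ closed]; exists (n * N + code n l n (fun=> Ordinal m_gt0)).
    exact: code_last_layer size_data _.
  exact: (closed_reachable size_data (fun=> Ordinal m_gt0) T0 closed (leqnn n)).
(* One summand for each phase. *)
have main : halts register_bound (map_program m) (init_memory l)
    ((2 + ((n + n) * 5).+1) + ((2 + (2 + (n * N * (m * 2).+2.+3).+1)) +
      ((2 + (N * (m * 5).+2.+3).+1) + 4)))
    (fun s => exists T, [/\ 0 < s 1, ok T &
       best_below n W m T (n * N + N) (output s)]).
  apply: halts_seq; apply: halts_weaken (leqnn _) _
    (halts_compute_radix size_data sum_V size_V) => s1 init1.
  apply: halts_seq; apply: halts_weaken (leqnn _) _
    (halts_fill_table size_data W_gt0 (leqnn _) (reachable0 n l m_gt0) _ init1).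
    move=> s2 table2.
    apply: halts_seq; apply: halts_weaken (leqnn _) _
      (halts_scan_last_layer size_data W_gt0 (leqnn _) m_gt0 okP table2) => s3.
    move=> best3; apply: halts_weaken (leqnn _) _ (halts_return_best best3).
    by move=> s4 [_ [T ?]]; exists T.
  exact: (reachableS size_data).
have [t [s [ex ht _ [T [q0 [T0 sound closed] best]]]]] := main bnd.
exists t, s; split=> //; last exact: best_is_optimum best.
  apply: leq_trans ht _; rewrite expnS mulnA leq_mul2r; apply/orP; right.
  by rewrite /register_bound; nia.
by rewrite -lt0n.
Qed.

End Instance.

(** A number of bit length at least 1 counts for at least 1 in the length of the
    instance, so that the number of integers is at most the length, and their sum
    at most the length times the largest one. *)
Lemma register_bound_le m (x : map_instance) :
  register_bound m x + 2 <=
  (@instance_length (MAP m) x + @largest_integer (MAP m) x + 2) ^ (4 * m + 2).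
Proof.
set len := instance_length _; set big := largest_integer _; set Y := len + big + 2.
set l : seq nat := nums x ++ dens x.
have bitlen_gt0 k : 0 < bitlen k by [].
have size_len : items x + items x <= len.
  rewrite -(size_data x) -sum1_size; by apply: leq_sum => k _; apply: bitlen_gt0.
have sum_le : sumn l <= len * big.
  rewrite sumnE /len /instance_length big_distrl /= big_seq [leqRHS]big_seq.
  apply: leq_sum => k k_l; apply: (@leq_trans (1 * big)).
    by rewrite mul1n; apply: leq_bigmax_seq.
  by rewrite leq_mul2r bitlen_gt0 orbT.
have radix_le : (sumn l).+1 <= Y ^ 2.
  have lt_square (a b : nat) : a * b < (a + b + 2) * (a + b + 2) by nia.
  by rewrite expnS expn1; exact: leq_ltn_trans sum_le (lt_square _ _).
have layer_le : (sumn l).+1 ^ (m + m) <= Y ^ (4 * m).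
  rewrite (_ : 4 * m = 2 * (m + m)); last by lia.
  by rewrite expnM; case: (m + m) => // k; rewrite leq_exp2r.
rewrite /register_bound -/l [Y ^ _]expnD; move: layer_le.
move: (_ ^ (m + m)) => N layer_le.
have Y_gt0 : 0 < Y ^ (4 * m) by rewrite expn_gt0 /Y addn2.
have items_le : items x + 1 <= Y by rewrite /Y; lia.
have Y_gt1 : 2 <= Y by rewrite /Y; lia.
move: (Y ^ (4 * m)) Y_gt0 layer_le => P P0 NP; rewrite expnS expn1; nia.
Qed.

(** The time bound as a polynomial: the outer variable is the largest integer,
    the inner one the length. *)
Lemma horner2_power (C E len big : nat) :
  ((C%:P%:P * ('X%:P + 'X + 2%:P%:P) ^+ E).[big%:P].[len])%R
  = C * (len + big + 2) ^ E.
Proof.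
rewrite !(hornerM, horner_exp, hornerD, hornerX, hornerC).
by rewrite natrXE.
Qed.

Theorem theorem6 (m : nat) (hm : (2 <= m)%N) : pseudo_polynomial_time (MAP m).
Proof.
have m_gt0 : 0 < m by apply: leq_trans hm.
set D := cost_exp (map_program m); set E := (4 * m + 2) * D.+1.
exists (map_program m), ((5 * m + 25)%:P%:P * ('X%:P + 'X + 2%:P%:P) ^+ E)%R => x.
have [t [s [ex le_t s1 opt]]] := map_program_correct x m_gt0.
exists t, s; split=> //; apply: leq_trans le_t _.
rewrite horner2_power leq_mul2l /E expnM; apply/orP; right.
by rewrite leq_exp2r // register_bound_le.
Qed.
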